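(* For all integers $d,m\ge1$ there exist constants $C_{m,d}>0$ and $C'_{m,d}>0$ such that for all $B>0$ and $n\ge1$: if $C_{m,d}Bn^{-m/d}>1$ then $e^{\mathrm{ad\text{-}stoch}}_n(\mathcal F_{d,m,B},S_{\mathrm{samp}},D_{\sup\text{-}\log})\le C'_{m,d}Bn^{-m/d}$, and if $C_{m,d}Bn^{-m/d}\le 1$ then $e^{\mathrm{ad\text{-}stoch}}_n(\mathcal F_{d,m,B},S_{\mathrm{samp}},D_{\sup\text{-}\log})\le C'_{m,d}(C_{m,d}Bn^{-m/d})^{n/2+1}$.
   Context: Let $\mathcal X=[0,1]^d$ with Lebesgue measure. For bounded measurable $f:\mathcal X\to\mathbb R$ let $Z_f=\int_{\mathcal X}e^{f}dx$ and $P_f$ the distribution with density $e^f/Z_f$; $S_{\mathrm{samp}}(f)=P_f$. For $f\in C^m(\mathcal X)$, $\|f\|_{C^m}=\sup_{|\alpha|_1\le m}\|\partial^\alpha f\|_\infty$, $\mathcal F_{d,m,B}=\{f\in C^m(\mathcal X):\|f\|_{C^m}\le B\}$. Sup-log distance: $D_{\sup\text{-}\log}(P,Q)=\|\log(dP/dQ)\|_\infty$ (essential sup over $\mathcal X$), $=\infty$ unless $P,Q$ are mutually absolutely continuous. Stochastic sampling algorithms: given a probability space $(\Omega,P_\Omega)$, a random sample has the form $X_f(\omega)=\tilde\phi(N(f,\omega),\omega)\in\mathcal X$, where $N(f,\omega)=(f(x_1),\dots,f(x_n))$ with each point $x_k$ allowed to depend on $\omega$ and on $f(x_1),\dots,f(x_{k-1})$;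 the associated map $\tilde S$ sends $f$ to the distribution of $X_f(\omega)$ for $\omega\sim P_\Omega$. $\mathcal A^{\mathrm{ad\text{-}stoch}}_n$ is the set of all such $\tilde S$ using $n$ evaluations, and $e^{\mathrm{ad\text{-}stoch}}_n(\mathcal F,S_{\mathrm{samp}},D)=\inf_{\tilde S\in\mathcal A^{\mathrm{ad\text{-}stoch}}_n}\sup_{f\in\mathcal F}D(P_f,\tilde S(f))$. *)

(* Defs.v *)
From HB Require Import structures.
From mathcomp Require Import all_boot all_order all_algebra.
From mathcomp Require Import all_classical all_reals all_analysis.
Set Implicit Arguments. Unset Strict Implicit. Unset Printing Implicit Defensive.
Import Order.TTheory GRing.Theory Num.Theory.
Import numFieldNormedType.Exports.
Local Open Scope classical_set_scope.
Local Open Scope ring_scope.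

Definition rV_display : measure_display. Proof. exact: default_measure_display. Qed.

Section rV_measurable.
Context (R : realType) (d : nat).
Let coor : 'I_d -> 'rV[R]_d -> measurableTypeR R := fun i x => x ord0 i.
Let rV_set0 : g_sigma_preimage coor set0.
Proof. exact: sigma_algebra0. Qed.
Let rV_setC A : g_sigma_preimage coor A -> g_sigma_preimage coor (~` A).
Proof. exact: sigma_algebraC. Qed.
Let rV_bigcup (F : _^nat) : (forall i, g_sigma_preimage coor (F i)) ->
  g_sigma_preimage coor (\bigcup_i (F i)).
Proof. exact: sigma_algebra_bigcup. Qed.
HB.instance Definition _ := @isMeasurable.Build rV_display
  'rV[R]_d (g_sigma_preimage coor) rV_set0 rV_setC rV_bigcup.
End rV_measurable.

Section defs.
Context (R : realType).

Definition cube (d : nat) : set 'rV[R]_d :=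
  [set x | forall i : 'I_d, 0 <= x ord0 i <= 1].
Arguments cube : clear implicits.

(* ---------- d-dimensional Lebesgue integral of nonnegative functions,
   defined as the iterated one-dimensional Lebesgue integral (Tonelli) *)
Fixpoint lebI (n : nat) : (n.-tuple R -> \bar R) -> \bar R :=
  match n return (n.-tuple R -> \bar R) -> \bar R with
  | 0 => fun g => g [tuple]
  | n'.+1 => fun g =>
      (\int[@lebesgue_measure R]_x lebI (fun t : n'.-tuple R => g (cons_tuple x t)))%E
  end.

Definition leb_int (d : nat) (g : 'rV[R]_d -> \bar R) : \bar R :=
  lebI (fun t : d.-tuple R => g (\row_i tnth t i)).

Definition Zf (d : nat) (f : 'rV[R]_d -> R) : \bar R :=
  leb_int (fun x => ((\1_(cube d) x : R) * expR (f x))%:E).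

Definition Pf (d : nat) (f : 'rV[R]_d -> R) : set 'rV[R]_d -> \bar R :=
  fun A => (fine (leb_int (fun x => ((\1_(A `&` cube d) x : R) * expR (f x))%:E))
            / fine (Zf f))%:E.

(* ---------- sup-log distance:  || log (dP/dQ) ||_oo (ess. sup w.r.t. Q),
   +oo unless P and Q are mutually absolutely continuous.  A density dP/dQ is
   a measurable h with P A = \int_A h dQ; mutual absolute continuity is
   exactly the existence of such an h with h > 0. *)
Definition D_suplog (d : nat) (P : set 'rV[R]_d -> \bar R)
  (Q : {measure set 'rV[R]_d -> \bar R}) : \bar R :=
  ereal_inf [set e : \bar R | exists h : 'rV[R]_d -> R,
    [/\ measurable_fun setT h, (forall x, 0 < h x),
        (forall A, measurable A -> P A = (\int[Q]_(x in A) (h x)%:E)%E) &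
        (\forall x \ae Q, ((`|ln (h x)|)%:E <= e)%E)]].

Definition evec (d : nat) (i : 'I_d) : 'rV[R]_d := delta_mx ord0 i.

Definition dpart (d : nat) (s : seq 'I_d) (f : 'rV[R]_d -> R) : 'rV[R]_d -> R :=
  foldr (fun i g => 'D_(evec i) g) f s.

Definition dalpha (d : nat) (alpha : 'I_d -> nat) (f : 'rV[R]_d -> R) :=
  dpart (flatten [seq nseq (alpha i) i | i <- enum 'I_d]) f.

Definition Cm (d m : nat) (f : 'rV[R]_d -> R) : Prop :=
  [/\ {within cube d, continuous f},
      (forall (s : seq 'I_d) i x, (size s < m)%N -> interior (cube d) x ->
         derivable (dpart s f) x (evec i)) &
      (forall s : seq 'I_d, (size s <= m)%N ->
         (forall x, interior (cube d) x -> {for x, continuous (dpart s f)}) /\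
         exists g : 'rV[R]_d -> R, {within cube d, continuous g} /\
           (forall x, interior (cube d) x -> dpart s f x = g x))].

Definition Cm_norm_le (d m : nat) (f : 'rV[R]_d -> R) (B : R) : Prop :=
  forall alpha : 'I_d -> nat, (\sum_i alpha i <= m)%N ->
    forall x, interior (cube d) x -> `|dalpha alpha f x| <= B.

Definition Fclass (d m : nat) (B : R) : set ('rV[R]_d -> R) :=
  [set f | Cm m f /\ Cm_norm_le m f B].

Record stoch_alg (d : nat) (Omega : Type) := StochAlg {
  next_pt : Omega -> seq R -> 'rV[R]_d ;
  out_pt : Omega -> seq R -> 'rV[R]_d }.

Definition info (d : nat) (Omega : Type) (A : stoch_alg d Omega)
    (f : 'rV[R]_d -> R) (w : Omega) (n : nat) : seq R :=
  iter n (fun ys => rcons ys (f (next_pt A w ys))) [::].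

Definition sample (d : nat) (Omega : Type) (A : stoch_alg d Omega) (n : nat)
    (f : 'rV[R]_d -> R) (w : Omega) : 'rV[R]_d :=
  out_pt A w (info A f w n).

Definition alg_in_cube (d : nat) (Omega : Type) (A : stoch_alg d Omega) :=
  (forall w ys, cube d (next_pt A w ys)) /\ (forall w ys, cube d (out_pt A w ys)).

Definition alg_error (d : nat) (dO : measure_display) (Omega : measurableType dO)
    (PO : probability Omega R) (A : stoch_alg d Omega) (n : nat)
    (F : set ('rV[R]_d -> R)) : \bar R :=
  ereal_sup [set e | exists f, F f /\ exists g : {mfun Omega >-> 'rV[R]_d},
     (g : Omega -> 'rV[R]_d) = sample A n f /\ e = D_suplog (Pf f) (distribution PO g)].

Definition err_adstoch (d n : nat) (F : set ('rV[R]_d -> R)) : \bar R :=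
  ereal_inf [set e | exists (dO : measure_display) (Omega : measurableType dO)
     (PO : probability Omega R) (A : stoch_alg d Omega),
     [/\ alg_in_cube A,
         (forall f, F f -> measurable_fun setT (sample A n f)) &
         e = alg_error PO A n F]].

End defs.

(* Main.v *)
(* Spend at most half of the n evaluations on a grid, and let fhat be any member of the
   class with the same grid values. Two members of the class that agree on the grid differ
   by O(B n^(-m/d)): this is a one-dimensional estimate applied to one coordinate after the
   other. The remaining k >= n/2 evaluations serve k rounds of rejection sampling for
   exp f, with proposals whose log-density is known and O(eps)-close to fhat up to an
   additive constant; if all rounds reject, the output is a fresh proposal. A round
   rejects with probability q = O(eps), so the density of the output relative to P_f is
   1 + q^k (p/p_f - 1), where p is the proposal density and p/p_f = 1 + O(eps); hence the
   error O(eps^(k+1)). *)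

Require Import Defs.
From HB Require Import structures.
From mathcomp Require Import all_boot all_order all_algebra.
From mathcomp Require Import all_classical all_reals all_analysis.
From mathcomp Require Import measurable_realfun.
From mathcomp Require Import ring lra zify.
Import Order.TTheory GRing.Theory Num.Theory.
Import numFieldNormedType.Exports.
Local Open Scope classical_set_scope.
Local Open Scope ring_scope.
Set Implicit Arguments. Unset Strict Implicit. Unset Printing Implicit Defensive.

(** * One-dimensional stability from values at nodes *)

Section one_dimension.
Context (R : realType).

(** A random algorithm fixes its probability space before f is known, so each sampler below is one
    space carrying proposals and coins, with the acceptance function quantified afterwards. Sampling
    exactly from the density proportional to exp fhat is avoided: once the grid values are known,
    fhat is an explicit function, so an inner rejection sampler with uniform proposals may run any
    number of rounds without spending an evaluation, and truncating it merely alters the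
    log-density, which stays explicit. Inaccurate proposals do not bias an accepted sample, whose
    law is exactly P_f; they only raise the rejection probability, so every further round gains a
    factor. Normalising constants are never computed: the acceptance is exp (f - ft - eta), and its
    mean is a multiple of Z that cancels in the final ratio. The class controls derivatives only in
    the interior and says nothing outside the cube; hence interior nodes, and [f \o clip] in place
    of f. *)

Lemma mvt_on (f df : R -> R) (I : set R) (x y : R) :
  (forall u v z, I u -> I v -> u <= z <= v -> I z) ->
  (forall z, I z -> is_derive z 1 f (df z)) ->
  I x -> I y -> x <= y ->
  exists2 c, x <= c <= y & f y - f x = df c * (y - x).
Proof.
move=> cI dI Ix Iy xy.
have [||c cxy ->] := @MVT_segment R f df x y xy.
- by move=> z; rewrite in_itv /= => /andP[xz zy]; apply: dI; apply: (cI x y) => //; rewrite !ltW.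
- apply: derivable_within_continuous => z; rewrite in_itv /= => xzy.
  by have [] := dI z (cI _ _ _ Ix Iy xzy).
- by exists c => //; move: cxy; rewrite in_itv.
Qed.

(** Here [q] bounds the ratio of interval length to node gap. Values at most e at both ends of a gap
    h force a slope at most 2e/h; integrating back over a length at most qh gives the factor 2q, and
    the value at the starting node gives the 1. *)
Fixpoint stability_const (q : R) (m : nat) : R :=
  if m is m'.+1 then 1 + 2 * q * stability_const q m' else 0.

Lemma stability_const_ge0 (q : R) m : 0 <= q -> 0 <= stability_const q m.
Proof. by move=> q0; elim: m => //= m ih; rewrite addr_ge0 // !mulr_ge0. Qed.

(* The mean value theorem on every other gap between consecutive nodes yields
   2^m nodes for the derivative which are still h-separated. *)
Lemma small_of_small_at_nodes (q : R) m (phi : nat -> R -> R) (I : set R)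
    (L h M e : R) (t : nat -> R) :
  0 < h -> 0 <= L -> L <= q * h -> 0 <= e ->
  (forall u v z, I u -> I v -> u <= z <= v -> I z) ->
  (forall u v, I u -> I v -> `|u - v| <= L) ->
  (forall k z, (k < m)%N -> I z -> is_derive z 1 (phi k) (phi k.+1 z)) ->
  (forall z, I z -> `|phi m z| <= M) ->
  (forall j, (j < 2 ^ m)%N -> I (t j) /\ `|phi 0%N (t j)| <= e) ->
  (forall j, (j.+1 < 2 ^ m)%N -> t j + h <= t j.+1) ->
  forall z, I z -> `|phi 0%N z| <= stability_const q m * e + M * L ^+ m.
Proof.
move=> h0 L0 Lqh; elim: m phi t e => [|m ih] phi t e e0 cI dI dphi bphi ht st z Iz.
  by rewrite mul0r add0r expr0 mulr1; exact: bphi.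
have q0 : 0 <= q by rewrite -(pmulr_lge0 _ h0) (le_trans L0).
have ex j : (j < 2 ^ m)%N -> exists c, t j.*2 <= c <= t j.*2.+1 /\
    (I c /\ `|phi 1%N c| <= 2 * e / h).
  move=> jm.
  have j1 : (j.*2.+1 < 2 ^ m.+1)%N by rewrite expnS; lia.
  have [I0 b0] := ht _ (ltnW j1); have [I1 b1] := ht _ j1.
  have st0 := st _ j1.
  have le01 : t j.*2 <= t j.*2.+1 by rewrite (le_trans _ st0) // lerDl ltW.
  have [c cin E] := mvt_on cI (fun z Iz => dphi 0%N z isT Iz) I0 I1 le01.
  exists c; split => //; split; first exact: (cI _ _ _ I0 I1 cin).
  rewrite ler_pdivlMr //.
  have : `|phi 1%N c| * h <= `|phi 1%N c * (t j.*2.+1 - t j.*2)|.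
    rewrite normrM ler_wpM2l //; apply: le_trans (ler_norm _); lra.
  move/le_trans; apply; rewrite -E (le_trans (ler_normB _ _)) //; lra.
have /choice[c hc] : forall j, exists c, (j < 2 ^ m)%N -> t j.*2 <= c <= t j.*2.+1 /\
    (I c /\ `|phi 1%N c| <= 2 * e / h).
  move=> j; case: (boolP (j < 2 ^ m)%N) => jm; last by exists 0.
  by have [c hc] := ex j jm; exists c.
have e20 : 0 <= 2 * e / h by rewrite divr_ge0 ?mulr_ge0 // ltW.
have b1 : forall y, I y -> `|phi 1%N y| <= stability_const q m * (2 * e / h) + M * L ^+ m.
  apply: (ih (fun k => phi k.+1) c) => //.
  - by move=> k y km; apply: dphi.
  - by move=> j jm; have [_] := hc j jm.
  - move=> j jm.
    have [/andP[_ a1] _] := hc j (ltnW jm); have [/andP[a2 _] _] := hc j.+1 jm.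
    have : (j.*2.+2 < 2 ^ m.+1)%N by rewrite expnS; lia.
    move/st; move: a2; rewrite doubleS; lra.
have [|I0 bt0] := ht 0%N; first by rewrite expn_gt0.
set b := stability_const q m * (2 * e / h) + M * L ^+ m.
(* The derivative bound [b] holds on all of I, so integrating back from the single node [t 0] is
   enough. *)
have key : `|phi 0%N z| <= e + b * L.
  have b1' c' (Ic : I c') (w : R) : `|w| <= L -> `|phi 1%N c' * w| <= b * L.
    by move=> wL; rewrite normrM ler_pM //; exact: b1.
  have [zt|/ltW tz] := leP z (t 0%N).
    have [c' cin E] := mvt_on cI (fun z Iz => dphi 0%N z isT Iz) Iz I0 zt.
    have -> : phi 0%N z = phi 0%N (t 0%N) - phi 1%N c' * (t 0%N - z) by rewrite -E; ring.
    by rewrite (le_trans (ler_normB _ _)) // lerD // b1' //; [exact: cI cin|exact: dI].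
  have [c' cin E] := mvt_on cI (fun z Iz => dphi 0%N z isT Iz) I0 Iz tz.
  have -> : phi 0%N z = phi 0%N (t 0%N) + phi 1%N c' * (z - t 0%N) by rewrite -E; ring.
  by rewrite (le_trans (ler_normD _ _)) // lerD // b1' //; [exact: cI cin|exact: dI].
apply: (le_trans key).
have -> : e + b * L = e + 2 * (L / h) * (stability_const q m * e) + M * L ^+ m.+1.
  by rewrite exprSr /b; ring.
have -> : stability_const q m.+1 * e = e + 2 * q * (stability_const q m * e).
  by rewrite /=; ring.
rewrite lerD2r lerD2l ler_wpM2r ?mulr_ge0 ?stability_const_ge0 // ler_wpM2l //.
by rewrite ler_pdivrMr.
Qed.

End one_dimension.

(** * Functions of the class agreeing on a grid *)

Section grid.
Context (R : realType) (d : nat).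
Implicit Types (x : 'rV[R]_d) (i j : 'I_d).

Definition open_cube x := forall i, 0 < x ord0 i < 1.

Lemma interior_cube x : open_cube x -> interior (@cube R d) x.
Proof.
move=> ox; rewrite /interior /=.
pose f i (y : 'rV[R]_d) : Prop := 0 <= y ord0 i <= 1.
apply: (@filter_forall _ _ f _ (@nbhs_filter _ x)) => i.
have /andP[x0 x1] := ox i.
have op : nbhs (x ord0 i) (`]0, 1[%classic : set R).
  by apply: open_nbhs_nbhs; split; [exact: interval_open|rewrite /= in_itv /= x0].
have H : nbhs x ((fun M : 'rV[R]_d => M ord0 i) @^-1` `]0, 1[%classic).
  exact: (@coord_continuous R 1 d ord0 i x _ op).
by apply: (@filterS _ (nbhs x) _ _ _ _ H) => y /=; rewrite /f in_itv /= => /andP[y0 y1]; rewrite !ltW.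
Qed.

Definition upd x j (t : R) : 'rV[R]_d := \row_i (if i == j then t else x ord0 i).

Lemma upd_id x j : upd x j (x ord0 j) = x.
Proof. by apply/rowP => i; rewrite mxE; case: eqP => // ->. Qed.

Lemma updD x j s t : upd x j (s + t) = s *: @evec R d j + upd x j t.
Proof.
by apply/rowP => i; rewrite !mxE eqxx /=; case: eqP; rewrite ?mulr1 ?mulr0 ?add0r.
Qed.

Lemma is_derive_line (g : 'rV[R]_d -> R) x j t :
  derivable g (upd x j t) (@evec R d j) ->
  is_derive t 1 (fun s => g (upd x j s)) ('D_(@evec R d j) g (upd x j t)).
Proof.
have E : (fun h : R => h^-1 *: (((fun s => g (upd x j s)) \o shift t) (h *: (1 : R)) - g (upd x j t)))
       = (fun h => h^-1 *: ((g \o shift (upd x j t)) (h *: @evec R d j) - g (upd x j t))).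
  by apply/funext => h /=; rewrite [_ *: 1]mulr1 updD.
by move=> dg; split; [rewrite /derivable E|rewrite /derive E].
Qed.

(** Moving one coordinate at a time only ever meets pure derivatives, the multi-indices supported at
    one [j]. *)
Lemma dalpha_pure (f : 'rV[R]_d -> R) j m :
  dalpha (fun i => if i == j then m else 0%N) f = dpart (nseq m j) f.
Proof.
rewrite /dalpha; congr (dpart _ f).
suff H s : uniq s -> flatten [seq nseq (if i == j then m else 0%N) i | i <- s] =
    (if j \in s then nseq m j else [::]).
  by rewrite H ?enum_uniq // mem_enum.
elim: s => //= a s ih /andP[as_ us]; rewrite ih // inE (eq_sym j).
by case: (eqVneq a j) as_ => [->|] //= /negbTE ->; rewrite cats0.
Qed.

Lemma dpart_pure_le m (f : 'rV[R]_d -> R) (B : R) j x : Cm_norm_le m f B -> open_cube x ->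
  `|dpart (nseq m j) f x| <= B.
Proof.
move=> hf ox; rewrite -dalpha_pure; apply: hf; last exact: interior_cube.
by rewrite -big_mkcond /= big_pred1_eq.
Qed.

Lemma Fclass_le m (f : 'rV[R]_d -> R) (B : R) x : Cm_norm_le m f B -> open_cube x ->
  `|f x| <= B.
Proof.
move=> hf ox; have := hf (fun=> 0%N); rewrite big1 // => /(_ isT x (interior_cube ox)).
rewrite /dalpha; suff -> : flatten [seq nseq 0 i | i <- enum 'I_d] = [::] by [].
by elim: (enum _).
Qed.

(** Midpoints of P equal cells: the half keeps the nodes off the boundary of [0,1], where
    derivatives are not controlled. *)
Definition node (P l : nat) : R := (l%:R + 2^-1) / P%:R.

Lemma node_bounds P l : (l < P)%N -> 0 < node P l < 1.
Proof.
move=> lP; have P0 : 0 < P%:R :> R by rewrite ltr0n; lia.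
have : l.+1%:R <= P%:R :> R by rewrite ler_nat.
rewrite /node divr_gt0 //= ?ltr_pdivrMr ?mul1r //.
by rewrite -natr1; lra.
Qed.

(** Error in units of 2 B N^(-m) after freeing k coordinates: each new one multiplies the old error
    by the stability constant and adds one unit. *)
Fixpoint grid_const (A : R) (k : nat) : R :=
  if k is k'.+1 then A * grid_const A k' + 1 else 0.

Lemma grid_const_ge0 A k : 0 <= A -> 0 <= grid_const A k.
Proof. by move=> A0; elim: k => //= k ih; rewrite addr_ge0 // mulr_ge0. Qed.

Lemma close_of_eq_on_grid m (B : R) (N : nat) (f g : 'rV[R]_d -> R) :
  (0 < N)%N -> Fclass m B f -> Fclass m B g ->
  (forall v : {ffun 'I_d -> 'I_(N * 2 ^ m)},
     f (\row_i node (N * 2 ^ m) (v i)) = g (\row_i node (N * 2 ^ m) (v i))) ->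
  forall x, open_cube x ->
  `|f x - g x| <= grid_const (stability_const (2 ^+ m) m) d * (2 * B * N%:R^-1 ^+ m).
Proof.
move=> N0 [Cf Bf] [Cg Bg] fg.
set A := stability_const _ _; set E := 2 * B * _; set P := (N * 2 ^ m)%N in fg *.
have A0 : 0 <= A by apply: stability_const_ge0; rewrite exprn_ge0.
have NR0 : 0 < N%:R :> R by rewrite ltr0n.
have K0 : (0 < 2 ^ m)%N by rewrite expn_gt0.
have P0 : 0 < P%:R :> R by rewrite ltr0n muln_gt0 N0.
have hP : N%:R^-1 = 2 ^+ m * P%:R^-1 :> R.
  rewrite /P natrM natrX; field; rewrite expf_neq0 ?gt_eqF //=.
(* Induction on the number of free coordinates: those of index at least k still sit at nodes. For k
   = 0 the point is a grid point. *)
suff H k : (k <= d)%N -> forall x, open_cube x ->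
    (forall i, (k <= i)%N -> exists2 l, (l < P)%N & x ord0 i = node P l) ->
    `|f x - g x| <= grid_const A k * E.
  move=> x ox; apply: (H d (leqnn d)) => // i; have := ltn_ord i; lia.
elim: k => [_|k ih kd] x ox hx.
  have /choice[v hv] i : exists l : 'I_P, x ord0 i = node P l.
    by have [//|l lP El] := hx i; exists (Ordinal lP).
  have -> : x = \row_i node P ([ffun i => v i] i).
    by apply/rowP => i; rewrite mxE ffunE.
  by rewrite fg subrr normr0 mul0r.
pose j := Ordinal kd.
have B0 : 0 <= B by apply: le_trans (Fclass_le Bf ox).
have E0 : 0 <= E by rewrite !mulr_ge0 // exprn_ge0 // invr_ge0 ltW.
have /andP[xj0 xj1] := ox j.
pose l := Num.truncn (x ord0 j * N%:R).
have xN0 : 0 <= x ord0 j * N%:R by rewrite mulr_ge0 ?ltW.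
have /andP[lx xl] : l%:R <= x ord0 j * N%:R < l.+1%:R by rewrite /l; exact: truncn_itv.
have lN : (l < N)%N.
  by rewrite -(ltr_nat R) (le_lt_trans lx) // -[ltRHS]mul1r ltr_pM2r.
(* The one of N cells that contains the coordinate. It holds 2^m nodes with gap 1/P, so length over
   gap is [2 ^+ m]. Intersecting with the open interval keeps all derivatives available. *)
pose I : set R := [set t | 0 < t < 1 /\ l%:R / N%:R <= t <= l.+1%:R / N%:R].
pose phi q t := dpart (nseq q j) f (upd x j t) - dpart (nseq q j) g (upd x j t).
have oupd t : 0 < t < 1 -> open_cube (upd x j t).
  by move=> ht i; rewrite mxE; case: eqP.
have Ix : I (x ord0 j).
  by split; [rewrite xj0 xj1|rewrite ler_pdivrMr // ler_pdivlMr // lx ltW].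
have -> : f x - g x = phi 0%N (x ord0 j) by rewrite /phi /= upd_id.
have -> : grid_const A k.+1 * E = A * (grid_const A k * E) + 2 * B * N%:R^-1 ^+ m.
  by rewrite /= mulrDl mul1r mulrA.
apply: (@small_of_small_at_nodes R (2 ^+ m) m phi I N%:R^-1 P%:R^-1 (2 * B)
   (grid_const A k * E) (fun r => node P (l * 2 ^ m + r))) => //.
- by rewrite invr_gt0.
- by rewrite hP.
- by rewrite mulr_ge0 // grid_const_ge0.
- move=> u v z [/andP[u0 _] /andP[u1 _]] [/andP[_ v0] /andP[_ v1]] /andP[uz zv]; split.
    by rewrite (lt_le_trans u0) //= (le_lt_trans zv).
  by rewrite (le_trans u1) //= (le_trans zv).
- move=> u v [_ /andP[u0 u1]] [_ /andP[v0 v1]].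
  have : l.+1%:R / N%:R = l%:R / N%:R + N%:R^-1 :> R by rewrite -natr1; field; rewrite gt_eqF.
  by rewrite ler_norml; lra.
- move=> q z qm [z01 _].
  have dd (u : 'rV[R]_d -> R) : Cm m u -> is_derive z 1 (fun s => dpart (nseq q j) u (upd x j s))
      (dpart (nseq q.+1 j) u (upd x j z)).
    move=> [_ du _]; apply: is_derive_line; apply: du; rewrite ?size_nseq //.
    exact/interior_cube/oupd.
  by have := dd _ Cf; have := dd _ Cg => ? ?; exact: is_deriveB.
- move=> z [z01 _]; rewrite /phi (le_trans (ler_normB _ _)) //.
  have := dpart_pure_le j Bf (oupd _ z01); have := dpart_pure_le j Bg (oupd _ z01); lra.
- move=> r rK.
  have lP : (l * 2 ^ m + r < P)%N by rewrite /P; nia.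
  split.
    split; first exact: node_bounds.
    have -> : l%:R / N%:R = (l * 2 ^ m)%:R / P%:R :> R.
      by rewrite hP mulrA natrM natrX.
    have -> : l.+1%:R / N%:R = (l.+1 * 2 ^ m)%:R / P%:R :> R.
      by rewrite hP mulrA natrM natrX.
    have : (l * 2 ^ m + r).+1%:R <= (l.+1 * 2 ^ m)%:R :> R by rewrite ler_nat; nia.
    rewrite /node !ler_pM2r ?invr_gt0 // -natr1 natrD; have := ler0n R r; lra.
  (* With coordinate [j] moved to a node, only k coordinates are free, so the induction hypothesis
     supplies the error at the nodes. *)
  apply: ih; [exact: ltnW|exact/oupd/node_bounds|] => i ki; rewrite mxE.
  case: eqVneq => [_|ij]; first by exists (l * 2 ^ m + r)%N.
  apply: hx; rewrite ltn_neqAle ki andbT; apply: contra ij => /eqP ki'.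
  by apply/eqP/val_inj.
- by move=> r _; rewrite /node -[X in _ + X]mul1r -mulrDl ler_pM2r ?invr_gt0 // addnS -natr1; lra.
Qed.

End grid.

(** * Clipping to the cube, and measurability for the coordinate sigma-algebra *)

Section cube_functions.
Context (R : realType) (d : nat).
Implicit Types (x : 'rV[R]_d) (i j : 'I_d).

(** A continuous retraction onto the cube: it turns continuity on the cube into continuity, hence
    measurability, on the whole space. *)
Definition clip x : 'rV[R]_d := \row_i Num.max 0 (Num.min 1 (x ord0 i)).

Lemma clip_cube x : @cube R d (clip x).
Proof.
by move=> i; rewrite mxE le_max lexx /= ge_max ler01 /= ge_min lexx.
Qed.

Lemma clip_id x : @cube R d x -> clip x = x.
Proof.
move=> cx; apply/rowP => i; rewrite mxE; have /andP[x0 x1] := cx i.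
by rewrite (min_idPr x1) (max_idPr x0).
Qed.

Lemma clip1_lipschitz (a b : R) :
  `|Num.max 0 (Num.min 1 a) - Num.max 0 (Num.min 1 b)| <= `|a - b|.
Proof.
wlog ab : a b / a <= b.
  move=> H; have [|/ltW] := leP a b; first exact: H.
  by rewrite distrC (distrC a); exact: H.
rewrite !ler0_norm ?subr_le0 ?ge_max ?le_max ?lexx ?le_min ?ge_min ?lexx ?ab ?orbT //=.
rewrite /Num.max /Num.min.
by case: (ltP 1 a); case: (ltP 1 b); rewrite ?ltr01; case: (ltP 0 a); case: (ltP 0 b); lra.
Qed.

Lemma clip_continuous : continuous clip.
Proof.
move=> x U /nbhs_ballP[e /= e0 he]; apply/nbhs_ballP; exists e => //= y [_ xy].
apply: he; split => // i j.
have := xy i j; rewrite !mxE !ord1 -!ball_normE /ball_ /=.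
exact/le_lt_trans/clip1_lipschitz.
Qed.

Lemma clip_continuous_comp (f : 'rV[R]_d -> R) :
  {within @cube R d, continuous f} -> continuous (f \o clip).
Proof.
move=> /subspace_continuousP cf x.
apply: (cvg_comp _ _ _ (cf _ (clip_cube x))) => U /= nU.
apply: (@filterS _ (nbhs x) _ _ _ _ (clip_continuous nU)) => y /=.
by apply; exact: clip_cube.
Qed.

Lemma le_cube_of_open_cube (G : 'rV[R]_d -> R) c : continuous G ->
  (forall x, open_cube x -> G x <= c) -> forall x, @cube R d x -> G x <= c.
Proof.
move=> cG oG x cx; apply/ler_addgt0Pr => e e0.
have /cvgrPdist_lt/(_ e e0) := cG x.
move=> /nbhs_ballP[r /= r0 hr].
pose s := Num.min (2^-1) (r / 2) : R.
have s0 : 0 < s by rewrite lt_min divr_gt0 // invr_gt0 ltr0n.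
have s2 : s <= 2^-1 by rewrite ge_min lexx.
have sr : s <= r / 2 by rewrite ge_min lexx orbT.
(* Moving towards the centre of the cube lands in the open cube, at distance less than [r] from
   x. *)
pose y : 'rV[R]_d := \row_i ((1 - s) * x ord0 i + s / 2).
have oy : open_cube y.
  by move=> i; rewrite mxE; have /andP[x0 x1] := cx i; apply/andP; split; nra.
have : ball x r y.
  split => // i j; rewrite !ord1 -ball_normE /ball_ /= mxE.
  have /andP[x0 x1] := cx j; rewrite ltr_norml; apply/andP; split; nra.
move=> /hr /=; rewrite ltr_norml => /andP[_]; have := oG _ oy; lra.
Qed.

Lemma measurable_coord i : measurable_fun setT (fun x => x ord0 i : R).
Proof.
move=> _ Y mY; rewrite setTI; apply: sub_sigma_algebra.
rewrite -bigcup_seq /=; exists i; first by rewrite /= mem_index_enum.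
exists Y => //.
by rewrite setTI.
Qed.

Lemma measurable_rV (dT : measure_display) (T : measurableType dT) (h : T -> 'rV[R]_d) :
  (forall i, measurable_fun setT (fun t => h t ord0 i)) -> measurable_fun setT h.
Proof.
move=> mh; pose coor i x : R := x ord0 i.
apply: (@measurability _ _ _ _ _ _
  (\big[setU/set0]_(i < d) preimage_set_system setT (coor i) measurable)) => //.
move=> _ [A + <-]; rewrite -bigcup_seq /= => -[i _ [Y mY <-]].
by have := mh i measurableT Y mY; rewrite !setTI.
Qed.

(** The sigma-algebra is generated by coordinates, the topology by the sup norm; they meet because U
    is a countable union of boxes with rational centres and radii 1/(n+1). *)
Lemma open_measurable_rV (U : set 'rV[R]_d) : open U -> measurable U.
Proof.
move=> oU.
pose bx (q : 'rV[rat]_d * nat) : set 'rV[R]_d :=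
  [set x | forall i, `|ratr (q.1 ord0 i) - x ord0 i| < q.2.+1%:R^-1].
have -> : U = \bigcup_q (if `[< bx q `<=` U >] then bx q else set0).
  apply/seteqP; split => [x Ux|x [q _]]; last by case: asboolP => // h /h.
  have /nbhs_ballP[e /= e0 he] : nbhs x U by apply: open_nbhs_nbhs.
  have [n hn] : exists n, n.+1%:R^-1 < e / 2.
    have := @near_infty_natSinv_lt R (PosNum (divr_gt0 e0 (ltr0n R 2))).
    by case=> n _ /(_ n (leqnn n)); exists n.
  have /choice[q hq] i : exists q : rat, `|ratr q - x ord0 i| < n.+1%:R^-1.
    have n0 : 0 < n.+1%:R^-1 :> R by rewrite invr_gt0.
    have [|q /[!in_itv]/= /andP[q1 q2]] := @rat_in_itvoo R (x ord0 i) (x ord0 i + n.+1%:R^-1).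
      by rewrite ltrDl.
    exists q; rewrite gtr0_norm ?subr_gt0 //.
    by rewrite ltrBlDl.
  exists ((\row_i q i), n) => //.
  have bxx : bx (\row_i q i, n) x by move=> i; rewrite /= mxE.
  case: asboolP => // -[] y hy; apply: he; split => // i j.
  have -> : i = ord0 by apply: ord1.
  rewrite -ball_normE /ball_ /=.
  move: hn (bxx j) (hy j); rewrite /= !mxE; move: (n.+1%:R^-1) => t.
  by rewrite !ltr_norml; lra.
apply: countable_bigcupT_measurable => [|q]; first exact: countableP.
case: ifP => // _.
have -> : bx q = \bigcap_(i in [set: 'I_d]) [set x | `|ratr (q.1 ord0 i) - x ord0 i| < q.2.+1%:R^-1].
  by apply/seteqP; split => [x h i _|x h i]; [exact: h|exact: (h i)].
apply: fin_bigcap_measurable => // i _.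
rewrite -[X in measurable X]setTI.
have : measurable_fun setT (fun x => `|ratr (q.1 ord0 i) - x ord0 i| < q.2.+1%:R^-1).
  apply: measurable_fun_ltr => //; apply: measurableT_comp => //.
  by apply: measurable_funB => //; exact: measurable_coord.
move=> /(_ measurableT [set true]); apply.
by [].
Qed.

Lemma continuous_measurable_rV (g : 'rV[R]_d -> R) : continuous g -> measurable_fun setT g.
Proof.
move=> /continuousP cg.
apply: (measurability _ (RGenOpens.measurableE R)) => _ [_ [a [b ->] <-]].
by rewrite setTI; apply: open_measurable_rV; apply: cg; exact: interval_open.
Qed.

End cube_functions.

(** * Grid approximation at the rate n^(-m/d) *)

Section grid_approximation.
Context (R : realType) (d m : nat).

Lemma Fclass_continuous (B : R) (f : 'rV[R]_d -> R) :
  Fclass m B f -> continuous (f \o @clip R d).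
Proof. by move=> [[cf _ _] _]; exact: clip_continuous_comp. Qed.

Lemma Fclass_bounded (B : R) (f : 'rV[R]_d -> R) : Fclass m B f ->
  forall x, `|f (clip x)| <= B.
Proof.
move=> Ff x; have cf := Fclass_continuous Ff.
rewrite -[clip x](clip_id (clip_cube x)).
apply: (@le_cube_of_open_cube R d (fun y => `|(f \o @clip R d) y|)) (clip_cube x) => [y|y oy /=].
  exact: (continuous_comp (cf y) (@norm_continuous _ _ _)).
rewrite clip_id; first by case: Ff => _ /Fclass_le; exact.
by move=> i; have /andP[y0 y1] := oy i; rewrite !ltW.
Qed.

Lemma max_grid_size (K p : nat) : (0 < d)%N -> (0 < K)%N ->
  exists N, ((N * K) ^ d <= p)%N /\ (p < (N.+1 * K) ^ d)%N.
Proof.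
move=> d0 K0.
have ex : exists N, ((N * K) ^ d <= p)%N by exists 0%N; rewrite mul0n exp0n.
have ub N : ((N * K) ^ d <= p)%N -> (N <= p)%N.
  apply: leq_trans; rewrite (@leq_trans (N * K)) ?leq_pmulr //.
  case: (posnP (N * K)) => [->//|NK0]; rewrite -[X in (X <= _)%N]expn1.
  by rewrite leq_pexp2l.
case: (ex_maxnP ex ub) => N hN mx; exists N; split => //.
by rewrite ltnNge; apply/negP => /mx; rewrite ltnn.
Qed.

(** The 4 in the hypothesis leaves room for two losses of a factor 2: only half of the n evaluations
    go to the grid, and maximality of N concerns N + 1, which is at most 2N. *)
Lemma rate_le (K N n : nat) : (0 < d)%N -> (0 < N)%N -> (0 < n)%N ->
  (n <= (4 * (N * K)) ^ d)%N ->
  N%:R^-1 ^+ m <= (4 * K%:R) ^+ m * n%:R `^ (- (m%:R / d%:R)) :> R.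
Proof.
move=> d0 N0 n0 nle.
have NR : 0 < N%:R :> R by rewrite ltr0n.
have nR : 0 < n%:R :> R by rewrite ltr0n.
have nd : n%:R `^ (m%:R / d%:R) <= (4 * (N%:R * K%:R)) ^+ m :> R.
  have -> : (4 * (N%:R * K%:R)) ^+ m = ((4 * (N%:R * K%:R)) ^+ d) `^ (m%:R / d%:R) :> R.
    rewrite -!powR_mulrn ?mulr_ge0 // -powRrM; congr (_ `^ _).
    by rewrite mulrC divfK // pnatr_eq0 -lt0n.
  apply: ge0_ler_powR; rewrite ?divr_ge0 // ?nnegrE ?exprn_ge0 ?mulr_ge0 //.
  by rewrite -!natrM -natrX ler_nat.
rewrite powRN ler_pdivlMr ?powR_gt0 // exprVn mulrC ler_pdivrMr ?exprn_gt0 //.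
by apply: (le_trans nd); rewrite -exprMn -mulrA (mulrC K%:R).
Qed.

Lemma grid_approximation : (0 < d)%N -> exists2 c0 : R, 0 < c0 &
  forall n, (0 < n)%N -> exists G : seq 'rV[R]_d, [/\ (size G <= n./2)%N,
    {in G, forall x, @cube R d x} &
    forall (B : R) f g, 0 < B -> Fclass m B f -> Fclass m B g -> [seq f x | x <- G] = [seq g x | x <- G] ->
    forall x, `|f (clip x) - g (clip x)| <= c0 * (B * n%:R `^ (- (m%:R / d%:R)))].
Proof.
move=> d0; pose A := stability_const (2 ^+ m : R) m.
have A0 : 0 <= A by apply: stability_const_ge0; rewrite exprn_ge0.
pose c1 := grid_const A d; have c10 : 0 <= c1 by exact: grid_const_ge0.
pose K := (2 ^ m)%N; have K0 : (0 < K)%N by rewrite expn_gt0.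
exists ((c1 + 1) * 2 * (4 * K%:R) ^+ m) => [|n n0].
  by rewrite mulr_gt0 // ?exprn_gt0 ?mulr_gt0 ?ltr0n // ltr_wpDl.
have [N [hN1 hN2]] := max_grid_size n./2 d0 K0.
have nN : (n <= 2 * (N.+1 * K) ^ d)%N.
  have : (n./2.+1 <= (N.+1 * K) ^ d)%N by [].
  by have := odd_double_half n; case: (odd n) => /=; lia.
have d2 : (2 <= 2 ^ d)%N by rewrite -[X in (X <= _)%N]expn1 leq_pexp2l.
(* If not even one cell per axis is affordable, n is bounded in terms of K and d, the rate is
   bounded below, and the trivial bound 2B with an empty grid suffices. *)
have [N0|N0] := posnP N.
  exists [::]; split => // B f g B0 Ff Fg _ x.
  have rl : 1 <= (4 * K%:R) ^+ m * n%:R `^ (- (m%:R / d%:R)) :> R.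
    have := @rate_le K 1 n d0 isT n0; rewrite invr1 expr1n; apply.
    rewrite (leq_trans nN) // N0 [X in (_ <= X)%N]expnMn leq_mul //.
    by rewrite (leq_trans d2) // leq_exp2r.
  rewrite (le_trans (ler_normB _ _)) //.
  have := Fclass_bounded Ff x; have := Fclass_bounded Fg x.
  have -> : (c1 + 1) * 2 * (4 * K%:R) ^+ m * (B * n%:R `^ (- (m%:R / d%:R))) =
            (c1 + 1) * 2 * B * ((4 * K%:R) ^+ m * n%:R `^ (- (m%:R / d%:R))) by ring.
  move: (_ * n%:R `^ _) rl => r rl ? ?.
  have : (c1 + 1) * 2 * B <= (c1 + 1) * 2 * B * r by rewrite ler_peMr // !mulr_ge0 ?addr_ge0 // ltW.
  have : 0 <= c1 * B by rewrite mulr_ge0 // ltW.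
  nra.
exists [seq \row_i node R (N * K) (v i) | v : {ffun 'I_d -> 'I_(N * K)} <- enum {: {ffun 'I_d -> 'I_(N * K)}}]; split.
- by rewrite size_map -cardE card_ffun !card_ord.
- move=> _ /mapP[v _ ->] i; rewrite mxE.
  by have /andP[? ?] := @node_bounds R (N * K) (v i) (ltn_ord _); rewrite !ltW.
move=> B f g B0 Ff Fg fg x.
have rl : N%:R^-1 ^+ m <= (4 * K%:R) ^+ m * n%:R `^ (- (m%:R / d%:R)) :> R.
  apply: rate_le => //.
  rewrite (leq_trans nN) // (@leq_trans (2 ^ d * (N.+1 * K) ^ d)) ?leq_mul // -expnMn.
  by rewrite leq_exp2r //; nia.
have oc y : open_cube y -> `|(f \o @clip R d) y - (g \o @clip R d) y| <= c1 * (2 * B * N%:R^-1 ^+ m).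
  move=> oy; rewrite /= clip_id; last by move=> i; have /andP[? ?] := oy i; rewrite !ltW.
  apply: close_of_eq_on_grid => // v.
  move: fg; rewrite -!map_comp => /eq_in_map/(_ v); apply.
  by rewrite -enumT mem_enum.
rewrite -[clip x](clip_id (clip_cube x)).
have := @le_cube_of_open_cube R d (fun y => `|(f \o @clip R d) y - (g \o @clip R d) y|) _ _ oc _ (clip_cube x).
move=> h; apply: le_trans (h _) _.
  move=> y; have cf : {for y, continuous (f \o @clip R d)} by exact: (Fclass_continuous Ff).
  have cg : {for y, continuous (g \o @clip R d)} by exact: (Fclass_continuous Fg).
  have cfg := continuousB cf cg.
  exact: (continuous_comp cfg (@norm_continuous _ _ _)).
have -> : (c1 + 1) * 2 * (4 * K%:R) ^+ m * (B * n%:R `^ (- (m%:R / d%:R))) =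
          (c1 + 1) * (2 * B * ((4 * K%:R) ^+ m * n%:R `^ (- (m%:R / d%:R)))) by ring.
apply: ler_pM => //; first by rewrite !mulr_ge0 ?exprn_ge0 ?invr_ge0 // ltW.
- by rewrite lerDl.
- by rewrite ler_wpM2l // mulr_ge0 // ltW.
Qed.

End grid_approximation.

(** * The uniform distribution on the cube *)

Section cube_probability.
Context (R : realType).
Local Open Scope ereal_scope.

Definition unit_uniform : probability (measurableTypeR R) R := uniform_prob (@ltr01 R).

Definition vcons n (x : R) (v : 'rV[R]_n) : 'rV[R]_n.+1 :=
  \row_i (if unlift ord0 i is Some j then v ord0 j else x).

Lemma row_cons_tuple n (x : R) (t : n.-tuple R) :
  \row_i tnth (cons_tuple x t) i = vcons x (\row_i tnth t i).
Proof.
apply/rowP => i; rewrite !mxE; case: unliftP => [j|] -> /=; last by rewrite (tnth_nth x).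
by rewrite mxE !(tnth_nth x).
Qed.

Lemma leb_intS n (G : 'rV[R]_n.+1 -> \bar R) :
  leb_int G = \int[@lebesgue_measure R]_x leb_int (fun v => G (vcons x v)).
Proof.
apply: eq_integral => x _; rewrite /leb_int; congr (lebI _).
by apply/funext => t; rewrite row_cons_tuple.
Qed.

Lemma leb_int0 n : leb_int (fun _ : 'rV[R]_n => 0) = 0.
Proof.
rewrite /leb_int; elim: n => //= n ih.
by rewrite (eq_integral (cst 0)) ?integral0 // => x _; rewrite ih.
Qed.

Lemma cube_vcons n (x : R) (v : 'rV[R]_n) :
  @cube R n.+1 (vcons x v) <-> ((0 <= x <= 1)%R /\ @cube R n v).
Proof.
split => [h|[hx hv] i].
  split; first by have := h ord0; rewrite mxE unlift_none.
  by move=> i; have := h (lift ord0 i); rewrite mxE liftK.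
by rewrite mxE; case: unliftP.
Qed.

Lemma measurable_vcons n :
  measurable_fun setT (fun xv : measurableTypeR R * 'rV[R]_n => vcons xv.1 xv.2).
Proof.
apply: measurable_rV => i; case: (unliftP ord0 i) => [j|] ->.
  rewrite (_ : (fun _ => _) = (fun v : 'rV[R]_n => v ord0 j) \o snd).
    by apply: measurableT_comp => //; exact: measurable_coord.
  by apply/funext => xv; rewrite mxE liftK.
rewrite (_ : (fun _ => _) = fst) //.
by apply/funext => xv; rewrite mxE unlift_none.
Qed.

Definition mk_mfun d1 d2 (T1 : measurableType d1) (T2 : measurableType d2) (h : T1 -> T2)
  (mh : measurable_fun setT h) : {mfun T1 >-> T2} := HB.pack h (isMeasurableFun.Build _ _ _ _ h mh).

Lemma cube_probability n : exists P : probability 'rV[R]_n R,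
  forall g : 'rV[R]_n -> \bar R, measurable_fun setT g -> (forall x, 0 <= g x) ->
  \int[P]_x g x = leb_int (fun x => (\1_(@cube R n) x)%:E * g x).
Proof.
elim: n => [|n [P hP]].
  exists (\d_ (0%R : 'rV[R]_0)) => g mg g0.
  rewrite integral_dirac // diracT mul1e /leb_int /= indicE mem_set ?mul1e.
    by congr g; apply/rowP => -[].
  by move=> -[].
pose V := mk_mfun (@measurable_vcons n).
exists (distribution (unit_uniform \x P) V) => g mg g0.
have mgV : measurable_fun setT (g \o V) by apply: measurableT_comp.
rewrite ge0_integral_distribution // fubini_tonelli1 //; last by move=> x; exact: g0.
rewrite integral_uniform; last 2 first.
- exact: (measurable_fun_fubini_tonelli_F _ mgV (fun x => g0 _)).
- by move=> x; apply: integral_ge0 => v _; exact: g0.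
rewrite subr0 invr1 mul1e leb_intS integral_mkcond; apply: eq_integral => x _.
rewrite patchE; case: ifPn => [|xn].
  rewrite inE /= in_itv /= => x01; rewrite /fubini_F /= hP; last 2 first.
  - have mp : measurable_fun setT (pair x : 'rV[R]_n -> measurableTypeR R * 'rV[R]_n).
      exact: pair1_measurable.
    exact: (measurableT_comp mg (measurableT_comp (@measurable_vcons n) mp)).
  - by move=> v; exact: g0.
  congr leb_int; apply/funext => v; congr (_%:E * _).
  rewrite !indicE; congr (_%:R); congr nat_of_bool; apply/idP/idP; rewrite !inE.
    by move=> cv; apply/cube_vcons.
  by move=> /cube_vcons[].
transitivity (leb_int (fun _ : 'rV[R]_n => 0)); first by rewrite leb_int0.
congr leb_int; apply/funext => v.
rewrite indicE memNset ?mul0e // => /cube_vcons[x01 _].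
by move/negP: xn; apply; rewrite inE /= in_itv.
Qed.

End cube_probability.

(** * Rejection sampling *)

Section rejection.
Context (R : realType).
Local Open Scope ereal_scope.

Lemma integral_uniform_if (c : R) (A B : \bar R) : (0 <= c <= 1)%R -> 0 <= A -> 0 <= B ->
  \int[unit_uniform R]_t (if (t <= c)%R then A else B) = A * c%:E + B * (1 - c)%:E.
Proof.
move=> /andP[c0 c1] A0 B0.
have mc : measurable (`]-oo, c]%classic : set (measurableTypeR R)) by exact: measurable_itv.
have Uc : unit_uniform R `]-oo, c]%classic = c%:E.
  rewrite -[LHS]mul1e -integral_cst // integral_mkcond integral_uniform.
  - rewrite subr0 invr1 mul1e -integral_mkcondr integral_cst; last exact: measurableI.
    rewrite mul1e.
    rewrite (_ : _ `&` _ = `[0%R, c]%classic).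
      apply: (eq_trans (lebesgue_measure_itv `[0%R, c])); rewrite /= lte_fin.
      by case: ltgtP c0 => //= [h0 _|<- _]; rewrite ?EFinN ?oppe0 ?adde0.
    apply/seteqP; split => x /=; rewrite !in_itv /=; first by case=> /andP[-> _].
    by move=> /andP[-> xc]; rewrite xc (le_trans xc).
  - by apply/(measurable_restrictT _ _).1 => //; exact: measurable_cst.
  - by move=> x; rewrite patchE; case: ifP.
have UcC : unit_uniform R (~` `]-oo, c]%classic) = (1 - c)%:E.
  by rewrite probability_setC // Uc EFinB.
rewrite -(setUv `]-oo, c]%classic) ge0_integral_setU //.
- rewrite (eq_integral (cst A)); last by move=> t; rewrite inE /= in_itv /= => ->.
  rewrite [X in _ + X](eq_integral (cst B)); last first.
    by move=> t; rewrite inE /= in_itv /= => /negP/negbTE ->.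
  rewrite integral_cst // integral_cst; last exact: measurableC.
  by rewrite -Uc -UcC.
- exact: measurableC.
- rewrite setUv; apply: measurable_fun_ifT => //; exact: measurable_fun_ler.
- by move=> t _; case: ifP.
- exact/disj_setPCl.
Qed.

Definition geom (q : R) k : R := (\sum_(i < k) q ^+ i)%R.

Lemma geomS (q : R) k : geom q k.+1 = (1 + q * geom q k)%R.
Proof.
rewrite /geom big_ord_recl expr0; congr (_ + _)%R; rewrite big_distrr /=.
by apply: eq_bigr => i _; rewrite exprS.
Qed.

Lemma geom_ge0 (q : R) k : (0 <= q)%R -> (0 <= geom q k)%R.
Proof. by move=> q0; apply: sumr_ge0 => i _; rewrite exprn_ge0. Qed.

Lemma geom_mul (q : R) k : ((1 - q) * geom q k = 1 - q ^+ k)%R.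
Proof. by rewrite /geom -[(1 - q)%R]opprB mulNr -subrX1 opprB. Qed.

Section acceptance.
Context (d0 : measure_display) (T0 : measurableType d0) (P0 : probability T0 R).
Variable a : T0 -> R.
Hypothesis ma : measurable_fun setT a.
Hypothesis a01 : forall w, (0 <= a w <= 1)%R.

Definition reject_prob : R := (1 - fine (\int[P0]_w (a w)%:E))%R.

Lemma accept_integral_bounds : 0 <= \int[P0]_w (a w)%:E <= 1.
Proof.
apply/andP; split.
  by apply: integral_ge0 => w _; rewrite lee_fin; have /andP[] := a01 w.
rewrite -(@probability_setT _ _ _ P0) -[leRHS]mul1e -integral_cst //.
apply: ge0_le_integral => //.
- by move=> w _; rewrite lee_fin; have /andP[] := a01 w.
- exact/measurable_EFinP.
- by move=> w _; rewrite lee_fin; have /andP[] := a01 w.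
Qed.

Lemma accept_integral_fin : \int[P0]_w (a w)%:E \is a fin_num.
Proof.
have /andP[i0 i1] := accept_integral_bounds.
by rewrite ge0_fin_numE // (le_lt_trans i1) // ltry.
Qed.

Lemma reject_prob_bounds : (0 <= reject_prob <= 1)%R.
Proof.
have := accept_integral_bounds; rewrite -(fineK accept_integral_fin) !lee_fin /reject_prob.
lra.
Qed.

Lemma integral_reject : \int[P0]_w (1 - a w)%:E = reject_prob%:E.
Proof.
have m1a : measurable_fun setT (fun w => (1 - a w)%:E).
  by apply/measurable_EFinP; apply: measurable_funB.
have : \int[P0]_w (1 - a w)%:E + \int[P0]_w (a w)%:E = 1.
  rewrite -ge0_integralD //.
  - under eq_integral do rewrite -EFinD subrK.
    by rewrite integral_cst // mul1e; exact: probability_setT.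
  - by move=> w _; rewrite lee_fin subr_ge0; have /andP[] := a01 w.
  - by move=> w _; rewrite lee_fin; have /andP[] := a01 w.
  - exact/measurable_EFinP.
rewrite /reject_prob EFinB (fineK accept_integral_fin) => <-.
by rewrite addeK // accept_integral_fin.
Qed.

End acceptance.

(** Round i is reached with probability q^i, so acceptances contribute [geom q k * a] to the density
    relative to [P0]. If no round accepts, [find] returns k and [x k], a proposal never tested, is
    output: this is the term q^k. Neither the space nor [x], [u] depends on [a]. *)
Lemma rejection_sampler (d0 : measure_display) (T0 : measurableType d0)
    (P0 : probability T0 R) (k : nat) :
  exists (dO : measure_display) (Om : measurableType dO) (P : probability Om R)
    (x : nat -> Om -> T0) (u : nat -> Om -> R),
  forall a : T0 -> R, measurable_fun setT a -> (forall w, (0 <= a w <= 1)%R) ->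
  let out w := x (find (fun j => (u j w <= a (x j w))%R) (iota 0 k)) w in
  measurable_fun setT out /\
  forall g : T0 -> \bar R, measurable_fun setT g -> (forall w, 0 <= g w) ->
  \int[P]_w g (out w) = \int[P0]_w
    (g w * (geom (reject_prob P0 a) k * a w + reject_prob P0 a ^+ k)%:E).
Proof.
elim: k => [|k [dO [Om [P [x [u H]]]]]].
  exists d0, T0, P0, (fun _ w => w), (fun _ _ => 0%R) => a ma a01 /=; split => // g mg g0.
  by apply: eq_integral => w _; rewrite /geom big_ord0 mul0r add0r expr0 mule1.
(* The new round goes in front and shifts the old ones, so after a first rejection the old sampler
   runs unchanged. *)
exists _, ((T0 * measurableTypeR R) * Om)%type, ((P0 \x unit_uniform R) \x P),
  (fun j w => if j is j'.+1 then x j' w.2 else w.1.1),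
  (fun j w => if j is j'.+1 then u j' w.2 else w.1.2).
move=> a ma a01.
have [] := H a ma a01; set out := (fun w => _) => mout hout.
set out' := (fun w => _); set q := reject_prob P0 a in hout *.
have out'E : out' = fun w => if (w.1.2 <= a w.1.1)%R then w.1.1 else out w.2.
  apply/funext => w; rewrite /out' /=; case: ifP => // _.
  by rewrite -[1%N]addn0 iotaDl find_map.
have mfst : measurable_fun setT (fun w : (T0 * measurableTypeR R) * Om => w.1.1).
  exact: (measurableT_comp measurable_fst measurable_fst).
have msnd : measurable_fun setT (fun w : (T0 * measurableTypeR R) * Om => w.1.2).
  exact: (measurableT_comp measurable_snd measurable_fst).
have mout' : measurable_fun setT out'.
  rewrite out'E; apply: measurable_fun_ifT => //.
  - apply: measurable_fun_ler => //; exact: (measurableT_comp ma mfst).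
  - exact: (measurableT_comp mout measurable_snd).
split => // g mg g0.
pose Ik : \bar R := \int[P]_w g (out w).
have IkE : Ik = _ := hout g mg g0.
have Ik0 : 0 <= Ik by apply: integral_ge0.
have mgo : measurable_fun setT (fun w => g (out' w)) by exact: (measurableT_comp mg mout').
(* The old rounds are integrated first, giving the constant [Ik], then the coin, then the proposal.
   The result is the integral of g a plus q times [Ik]. *)
rewrite fubini_tonelli1 //.
rewrite (eq_integral (fun e : T0 * measurableTypeR R =>
  if ((e.2 : R) <= a e.1)%R then g e.1 else Ik)); last first.
  move=> e _; rewrite /fubini_F out'E /=; case: ifP => // _.
  by rewrite integral_cst // -[RHS]mule1; congr (_ * _); exact: probability_setT.
rewrite fubini_tonelli1; last 2 first.
- apply: measurable_fun_ifT.
  + apply: measurable_fun_ler => //; exact: (measurableT_comp ma measurable_fst).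
  + exact: (measurableT_comp mg measurable_fst).
  + exact: measurable_cst.
- by move=> e; case: ifP.
rewrite (eq_integral (fun w => g w * (a w)%:E + Ik * (1 - a w)%:E)%E); last first.
  by move=> w _; rewrite /fubini_F /= integral_uniform_if.
have ma' : measurable_fun setT (fun w => (a w)%:E) by exact/measurable_EFinP.
have m1a : measurable_fun setT (fun w => (1 - a w)%:E).
  by apply/measurable_EFinP; apply: measurable_funB.
have a0 w : 0 <= (a w)%:E by rewrite lee_fin; have /andP[] := a01 w.
have a1 w : 0 <= (1 - a w)%:E by rewrite lee_fin subr_ge0; have /andP[] := a01 w.
have /andP[q0 q1] : (0 <= q <= 1)%R by exact: reject_prob_bounds.
rewrite ge0_integralD //; last 4 first.
- by move=> w _; rewrite mule_ge0.
- exact: emeasurable_funM.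
- by move=> w _; rewrite mule_ge0.
- exact: measurable_funeM.
rewrite ge0_integralZl // integral_reject // -/q IkE muleC.
have s0 := geom_ge0 k q0.
have w0 w : 0 <= (geom q k * a w + q ^+ k)%:E.
  by rewrite lee_fin addr_ge0 // ?mulr_ge0 ?exprn_ge0 //; have /andP[] := a01 w.
have mw : measurable_fun setT (fun w => (geom q k * a w + q ^+ k)%:E).
  by apply/measurable_EFinP; apply: measurable_funD => //; apply: measurable_funM.
have mgw : measurable_fun setT (fun w => g w * (geom q k * a w + q ^+ k)%:E).
  exact: emeasurable_funM.
have gw0 w : 0 <= g w * (geom q k * a w + q ^+ k)%:E by rewrite mule_ge0.
rewrite -(ge0_integralZl P0 measurableT mgw (fun w _ => gw0 w) (_ : 0 <= q%:E)) //.
rewrite -ge0_integralD //; last 4 first.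
- by move=> w _; rewrite mule_ge0.
- exact: emeasurable_funM.
- by move=> w _; rewrite mule_ge0.
- exact: measurable_funeM.
apply: eq_integral => w _.
rewrite muleCA -ge0_muleDr //; last by rewrite mule_ge0.
rewrite -EFinM -EFinD geomS; congr (_ * _%:E); rewrite exprS; ring.
Qed.

End rejection.

(** * Proposals with an explicit log-density *)

Section proposals.
Context (R : realType) (d : nat) (lam : probability 'rV[R]_d R).
Hypothesis lamE : forall g : 'rV[R]_d -> \bar R, measurable_fun setT g -> (forall x, 0 <= g x)%E ->
  (\int[lam]_x g x = leb_int (fun x => (\1_(@cube R d) x)%:E * g x))%E.

Lemma eq_integral_cube (g h : 'rV[R]_d -> \bar R) :
  measurable_fun setT g -> measurable_fun setT h ->
  (forall x, 0 <= g x)%E -> (forall x, 0 <= h x)%E ->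
  (forall x, @cube R d x -> g x = h x) -> (\int[lam]_x g x = \int[lam]_x h x)%E.
Proof.
move=> mg mh g0 h0 gh; rewrite !lamE //; congr leb_int; apply/funext => x.
rewrite indicE; case: (boolP (x \in _)) => [|_]; last by rewrite !mul0e.
by rewrite inE => /gh ->.
Qed.

Lemma measurable_clip : measurable_fun setT (@clip R d).
Proof.
apply: measurable_rV => i.
rewrite (_ : (fun _ => _) = (fun x : 'rV[R]_d => Num.max 0 (Num.min 1 (x ord0 i)))); last first.
  by apply/funext => x; rewrite mxE.
by apply: measurable_maxr => //; apply: measurable_minr => //; exact: measurable_coord.
Qed.

Lemma exp_small (t e : R) : 0 <= t < 1 -> 0 < e -> exists k, t ^+ k.+1 < e.
Proof.
move=> /andP[t0 t1] e0.
have : t ^+ n @[n --> \oo] --> (0 : R) by apply: cvg_expr; rewrite ger0_norm.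
move=> /cvgrPdist_lt/(_ e e0)[k _ hk]; exists k; have /= := hk k.+1 (leqnSn k).
by rewrite sub0r normrN ger0_norm // exprn_ge0.
Qed.

(* Finitely many rejection steps with uniform proposals never produce the density
   proportional to exp f exactly, but the density they produce is explicit and has
   the form exp (ft + c) with ft uniformly close to f. *)
Lemma proposal_sampler (B e : R) : 0 < B -> 0 < e ->
  exists (dO : measure_display) (Om : measurableType dO) (P0 : probability Om R),
  forall f : 'rV[R]_d -> R, measurable_fun setT f -> (forall x, `|f x| <= B) ->
  exists (X : Om -> 'rV[R]_d) (ft : 'rV[R]_d -> R) (c : R),
  [/\ measurable_fun setT X, forall w, @cube R d (X w), measurable_fun setT ft,
    forall x, `|ft x - f x| <= e &
    forall g : 'rV[R]_d -> \bar R, measurable_fun setT g -> (forall x, 0 <= g x)%E ->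
    (\int[P0]_w g (X w) = \int[lam]_x (g x * (expR (ft x + c))%:E))%E].
Proof.
move=> B0 e0.
have t01 : 0 <= 1 - expR (- (2 * B)) < 1.
  have := expR_gt0 (- (2 * B)); have : expR (- (2 * B)) <= 1.
    by rewrite -[leRHS]expR0 ler_expR; lra.
  by move=> ? ?; apply/andP; split; lra.
(* Acceptance is at least exp (-2B), which bounds q away from 1 uniformly in f; so k depends on B
   and e alone. *)
have [k hk] := exp_small t01 (divr_gt0 e0 (expR_gt0 (2 * B))).
have [dO [Om [P0 [x [u H]]]]] := rejection_sampler lam k.+1.
exists dO, Om, P0 => f mf fB.
pose a y := expR (f y - B).
have ma : measurable_fun setT a.
  by apply: measurableT_comp => //; exact: measurable_funB.
have f1 y : - B <= f y <= B by rewrite -ler_norml.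
have a01 y : 0 <= a y <= 1.
  rewrite expR_ge0 /= -[leRHS]expR0 ler_expR; have /andP[? ?] := f1 y; lra.
have [] := H a ma a01; set out := (fun w => _) => mout hout.
set q := reject_prob lam a in hout.
have /andP[q0 q1] : 0 <= q <= 1 by exact: reject_prob_bounds.
have qt : q <= 1 - expR (- (2 * B)).
  rewrite /q /reject_prob lerD2l lerN2 -lee_fin fineK; last exact: accept_integral_fin.
  have -> : ((expR (- (2 * B)))%:E = \int[lam]_x (cst (expR (- (2 * B)))%:E) x)%E.
    by rewrite integral_cst // -[LHS]mule1; congr (_ * _)%E; apply/esym; exact: probability_setT.
  apply: ge0_le_integral => //.
  - by move=> y _; rewrite lee_fin expR_ge0.
  - exact/measurable_EFinP.
  - by move=> y _; rewrite lee_fin ler_expR; have /andP[? ?] := f1 y; lra.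
have s1 : 1 <= geom q k.+1 by rewrite geomS lerDl mulr_ge0 // geom_ge0.
pose kap := geom q k.+1 * expR (- B).
have kapB : expR (- B) <= kap by rewrite ler_peMl // expR_ge0.
have kap0 : 0 < kap by rewrite (lt_le_trans _ kapB) // expR_gt0.
(* The output density is [kap] times exp f + [r]. Since [r] is at most e exp (-B), hence at most e
   exp f, taking logarithms moves f by at most e. *)
pose r := q ^+ k.+1 / kap.
have r0 : 0 <= r by rewrite divr_ge0 ?exprn_ge0 // ltW.
have re : r <= e * expR (- B).
  have h1 : q ^+ k.+1 <= e / expR (2 * B).
    by apply: le_trans (ltW hk); apply: lerXn2r; rewrite ?nnegrE //; have /andP[] := t01.
  rewrite /r ler_pdivrMr // (le_trans h1) // -mulrA (ler_wpM2l (ltW e0)) //.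
  rewrite -expRN (le_trans _ (ler_wpM2l (expR_ge0 _) kapB)) // -expRD ler_expR; lra.
pose ft y := ln (expR (f y) + r).
have pos y : 0 < expR (f y) + r by rewrite ltr_wpDr // expR_gt0.
have ftE y : expR (ft y + ln kap) = geom q k.+1 * a y + q ^+ k.+1.
  rewrite expRD !lnK ?posrE // mulrDl /r divfK ?gt_eqF //; congr (_ + _).
  by rewrite /kap /a expRD mulrCA [X in _ = _ * X]mulrC mulrA mulrC; ring.
(* Query points must lie in the cube for every outcome, not almost surely; clipping ensures it, and
   [lam] does not charge the complement. *)
exists (@clip R d \o out), ft, (ln kap); split.
- exact: (measurableT_comp measurable_clip mout).
- by move=> w; exact: clip_cube.
- apply: measurableT_comp => //; apply: measurable_funD => //.
  exact: measurableT_comp.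
- move=> y.
  have l1 : f y <= ft y.
    by rewrite -[leLHS]expRK ler_ln ?posrE ?expR_gt0 // lerDl.
  rewrite ger0_norm ?subr_ge0 // lerBlDl -[leRHS]expRK ler_ln ?posrE ?expR_gt0 //.
  rewrite expRD (le_trans _ (ler_wpM2l (expR_ge0 _) (expR_ge1Dx e))) // mulrDr mulr1 lerD2l.
  rewrite (le_trans re) // mulrC (ler_wpM2r (ltW e0)) // ler_expR.
  by have /andP[] := f1 y.
- move=> g mg g0.
  have mgc : measurable_fun setT (g \o @clip R d) by exact: (measurableT_comp mg measurable_clip).
  rewrite (hout (g \o @clip R d)) //; last by move=> y; exact: g0.
  have mft : measurable_fun setT (fun y => (expR (ft y + ln kap))%:E).
    apply/measurable_EFinP; apply: measurableT_comp => //; apply: measurable_funD => //.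
    apply: measurableT_comp => //; apply: measurable_funD => //.
    exact: measurableT_comp.
  under eq_integral do rewrite -ftE.
  apply: eq_integral_cube.
  + exact: emeasurable_funM.
  + exact: emeasurable_funM.
  + by move=> y; rewrite mule_ge0 // ?lee_fin ?expR_ge0 //; exact: g0.
  + by move=> y; rewrite mule_ge0 // lee_fin expR_ge0.
  + by move=> y cy /=; rewrite clip_id.
Qed.

End proposals.

(** * The sup-log distance *)

Section log_ratio.
Context (R : realType).

Lemma ln_le_sub1 (x : R) : 0 < x -> ln x <= x - 1.
Proof. by move=> x0; have := expR_ge1Dx (ln x); rewrite lnK ?posrE //; lra. Qed.

(* Writing D for the denominator, both a and D lie in [exp (-t), 1], and
   D - a = q ^+ k * (1 - q - a). *)
Lemma log_ratio_bounds (a q t : R) k : 0 <= t ->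
  expR (- t) <= a <= 1 -> expR (- t) <= 1 - q <= 1 ->
  let h := a / ((1 - q ^+ k) * a + q ^+ k * (1 - q)) in
  `|ln h| <= t /\ (t <= 2^-1 -> `|ln h| <= 2 * t ^+ k.+1).
Proof.
move=> t0 /andP[a0 a1] /andP[q0 q1] h.
have E0 := expR_gt0 (- t).
have Et : 1 - t <= expR (- t) by have := expR_ge1Dx (- t); lra.
have qge0 : 0 <= q by lra.
have qk : 0 <= q ^+ k <= 1 by rewrite exprn_ge0 //= exprn_ile1 //; lra.
rewrite /h; set D := _ + _.
have /andP[D0 D1] : expR (- t) <= D <= 1.
  by move: qk => /andP[p0 p1]; rewrite /D; apply/andP; split; nra.
have apos : 0 < a by lra.
have Dpos : 0 < D by lra.
have lnb z : expR (- t) <= z <= 1 -> - t <= ln z <= 0.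
  move=> /andP[z0 z1]; have zp : 0 < z by lra.
  by rewrite -[X in X <= _]expRK ler_ln ?posrE // z0 /= ln_le0.
rewrite ln_div ?posrE //; split.
  have /andP[? ?] := lnb a (introT andP (conj a0 a1)).
  have /andP[? ?] := lnb D (introT andP (conj D0 D1)).
  by rewrite ler_norml; apply/andP; split; lra.
move=> th.
have aD : `|D - a| <= t ^+ k.+1.
  have -> : D - a = q ^+ k * (1 - q - a) by rewrite /D; ring.
  rewrite normrM exprSr ler_pM //.
    by rewrite ger0_norm ?exprn_ge0 // lerXn2r ?nnegrE //; lra.
  by rewrite ler_norml; apply/andP; split; lra.
(* For t at most 1/2 both a and [D] are at least 1/2, where the logarithm is 2-Lipschitz; this is
   the factor 2 of the bound. *)
have half z y : 0 < z -> 0 < y -> 2^-1 <= y -> `|z - y| <= t ^+ k.+1 ->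
    ln z - ln y <= 2 * t ^+ k.+1.
  move=> z0 y0 y2 zy; rewrite -ln_div ?posrE //.
  apply: (le_trans (ln_le_sub1 (divr_gt0 z0 y0))).
  rewrite -[X in _ - X](@divff _ y) ?gt_eqF // -mulrBl ler_pdivrMr //.
  by have := ler_norm (z - y); have := normr_ge0 (z - y); nra.
have := half D a Dpos apos; have := half a D apos Dpos.
rewrite (distrC a D) => /(_ _ aD) + /(_ _ aD).
rewrite ler_norml => H1 H2; apply/andP; split.
  by have := H2; lra.
by have := H1; lra.
Qed.

End log_ratio.

Section suplog.
Context (R : realType) (d : nat) (lam : probability 'rV[R]_d R).
Hypothesis lamE : forall g : 'rV[R]_d -> \bar R, measurable_fun setT g -> (forall x, 0 <= g x)%E ->
  (\int[lam]_x g x = leb_int (fun x => (\1_(@cube R d) x)%:E * g x))%E.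
Variables (f : 'rV[R]_d -> R) (B : R).
Let fc := f \o @clip R d.
Hypothesis mfc : measurable_fun setT fc.
Hypothesis fB : forall x, `|fc x| <= B.

Let mexp : measurable_fun setT (fun x => (expR (fc x))%:E).
Proof. by apply/measurable_EFinP; apply: measurableT_comp. Qed.

Lemma leb_int_exp (A : set 'rV[R]_d) : measurable A ->
  leb_int (fun x => ((\1_(A `&` @cube R d) x : R) * expR (f x))%:E) =
  (\int[lam]_(x in A) (expR (fc x))%:E)%E.
Proof.
move=> mA; rewrite integral_mkcond lamE; last 2 first.
- by apply/(measurable_restrictT _ _).1 => //; exact: measurable_funTS.
- by move=> x; rewrite patchE; case: ifP => // _; rewrite lee_fin expR_ge0.
congr leb_int; apply/funext => x; rewrite patchE setIC indicI /= !indicE.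
case: (boolP (x \in @cube R d)) => [|_]; last by rewrite !mul0r mul0e.
rewrite inE => cx; rewrite /fc /= clip_id //.
by case: ifP; rewrite !mul1r ?mul1e ?mul0r.
Qed.

Lemma ZfE : Zf f = (\int[lam]_x (expR (fc x))%:E)%E.
Proof.
by rewrite -(leb_int_exp measurableT) /Zf; congr leb_int; apply/funext => x; rewrite setTI.
Qed.

Lemma integral_exp_bounds (A : set 'rV[R]_d) : measurable A ->
  (0 <= \int[lam]_(x in A) (expR (fc x))%:E <= (expR B)%:E)%E.
Proof.
move=> mA; apply/andP; split; first by apply: integral_ge0 => x _; rewrite lee_fin expR_ge0.
apply: (@le_trans _ _ (\int[lam]_(x in A) (cst (expR B)%:E x))%E).
  apply: ge0_le_integral => //.
  - exact: measurable_funTS.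
  - by move=> x _; rewrite lee_fin ler_expR; apply: le_trans (fB x); exact: ler_norm.
rewrite integral_cst // -[leRHS]mule1 lee_wpmul2l ?lee_fin ?expR_ge0 //.
exact: probability_le1.
Qed.

Lemma integral_exp_fin (A : set 'rV[R]_d) : measurable A ->
  (\int[lam]_(x in A) (expR (fc x))%:E)%E \is a fin_num.
Proof.
move=> /integral_exp_bounds/andP[i0 i1].
by rewrite ge0_fin_numE // (le_lt_trans i1) // ltry.
Qed.

Lemma Zf_gt0 : 0 < fine (Zf f).
Proof.
apply: (@lt_le_trans _ _ (expR (- B))); first exact: expR_gt0.
rewrite ZfE -lee_fin fineK; last exact: integral_exp_fin.
have -> : ((expR (- B))%:E = \int[lam]_x (cst (expR (- B))%:E) x)%E.
  by rewrite integral_cst // -[LHS]mule1; congr (_ * _)%E; apply/esym; exact: probability_setT.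
apply: ge0_le_integral => //; first by move=> y _; rewrite lee_fin expR_ge0.
by move=> y _; rewrite lee_fin ler_expR; have := fB y; rewrite ler_norml => /andP[].
Qed.

(** The infimum needs a single witness: the quotient of the densities of P_f and of the law of X,
    both taken with respect to [lam]. *)
Lemma D_suplog_le (dO : measure_display) (Om : measurableType dO) (P : probability Om R)
    (X : {mfun Om >-> 'rV[R]_d}) (rho : 'rV[R]_d -> R) (e : R) :
  measurable_fun setT rho -> (forall x, 0 < rho x) ->
  (forall g : 'rV[R]_d -> \bar R, measurable_fun setT g -> (forall x, 0 <= g x)%E ->
    (\int[P]_w g (X w) = \int[lam]_x (g x * (rho x)%:E))%E) ->
  (forall x, `|ln (expR (fc x) / fine (Zf f) / rho x)| <= e) ->
  (D_suplog (Pf f) (distribution P X) <= e%:E)%E.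
Proof.
move=> mrho rho0 law he; apply: ereal_inf_lbound => /=.
have Z0 := Zf_gt0; set Z := fine (Zf f) in Z0 he *.
pose h x := expR (fc x) / Z / rho x.
have hE : h = fun x => expR (fc x - ln Z - ln (rho x)).
  by apply/funext => x; rewrite !expRD !expRN !lnK ?posrE.
have mh : measurable_fun setT h.
  rewrite hE; apply: measurableT_comp => //; apply: measurable_funB.
    exact: measurable_funB.
  exact: measurableT_comp.
have hpos x : 0 < h x by rewrite !divr_gt0 // expR_gt0.
exists h; split => //.
- move=> A mA; rewrite integral_mkcond.
  have mhA : measurable_fun setT ((fun x => (h x)%:E) \_ A).
    by apply/(measurable_restrictT _ _).1 => //; apply: measurable_funTS; exact/measurable_EFinP.
  have hA0 x : (0 <= ((fun x => (h x)%:E) \_ A) x)%E.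
    by rewrite patchE; case: ifP => // _; rewrite lee_fin ltW.
  rewrite ge0_integral_distribution // law //.
  rewrite (eq_integral (fun x => (Z^-1)%:E * ((fun x => (expR (fc x))%:E) \_ A) x)%E); last first.
    move=> x _; rewrite !patchE; case: ifP => _; last by rewrite mul0e mule0.
    by rewrite -!EFinM /h divfK ?gt_eqF // mulrC.
  have mexpA : measurable_fun setT ((fun x => (expR (fc x))%:E) \_ A).
    by apply/(measurable_restrictT _ _).1 => //; exact: measurable_funTS.
  rewrite ge0_integralZl //; last 2 first.
  - by move=> x _; rewrite patchE; case: ifP => // _; rewrite lee_fin expR_ge0.
  - by rewrite lee_fin invr_ge0 ltW.
  rewrite -integral_mkcond /Pf leb_int_exp // -(fineK (integral_exp_fin mA)) -EFinM.
  by rewrite mulrC.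
- by apply: aeW => x; rewrite lee_fin; exact: he.
Qed.

End suplog.

(** * The two-stage algorithm *)

Section outer_rejection.
Context (R : realType) (d : nat) (lam : probability 'rV[R]_d R).
Hypothesis lamE : forall g : 'rV[R]_d -> \bar R, measurable_fun setT g -> (forall x, 0 <= g x)%E ->
  (\int[lam]_x g x = leb_int (fun x => (\1_(@cube R d) x)%:E * g x))%E.

Lemma rejection_suplog (f ft : 'rV[R]_d -> R) (B c eta : R) k
    (d0 : measure_display) (T0 : measurableType d0) (P0 : probability T0 R) (X : T0 -> 'rV[R]_d)
    (dO : measure_display) (Om : measurableType dO) (P : probability Om R) (out : Om -> T0)
    (a : T0 -> R) (Y : {mfun Om >-> 'rV[R]_d}) :
  let fc := f \o @clip R d in
  measurable_fun setT fc -> (forall x, `|fc x| <= B) ->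
  measurable_fun setT ft -> (forall x, `|fc x - ft x| <= eta) ->
  (forall w, @cube R d (X w)) ->
  (forall g : 'rV[R]_d -> \bar R, measurable_fun setT g -> (forall x, 0 <= g x)%E ->
    (\int[P0]_w g (X w) = \int[lam]_x (g x * (expR (ft x + c))%:E))%E) ->
  measurable_fun setT X ->
  a = (fun w => expR (f (X w) - ft (X w) - eta)) ->
  (forall g : T0 -> \bar R, measurable_fun setT g -> (forall w, 0 <= g w)%E ->
    (\int[P]_w g (out w) = \int[P0]_w
      (g w * (geom (reject_prob P0 a) k * a w + reject_prob P0 a ^+ k)%:E))%E) ->
  (Y : Om -> 'rV[R]_d) = X \o out ->
  (D_suplog (Pf f) (distribution P Y) <= (2 * eta)%:E)%E /\
  (2 * eta <= 2^-1 -> (D_suplog (Pf f) (distribution P Y) <= (2 * (2 * eta) ^+ k.+1)%:E)%E).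
Proof.
move=> fc mfc fB mft ftf Xc lawX mX aE lawo YE.
have eta0 : 0 <= eta by apply: le_trans (ftf 0).
have ftf' x : - eta <= fc x - ft x <= eta by rewrite -ler_norml.
pose al x := expR (fc x - ft x - eta).
have mal : measurable_fun setT al.
  by apply: measurableT_comp => //; apply: measurable_funB => //; exact: measurable_funB.
have aal w : a w = al (X w) by rewrite aE /al /fc /= clip_id.
have ma : measurable_fun setT a.
  by rewrite (_ : a = al \o X); [exact: measurableT_comp|apply/funext].
(* Subtracting [eta] makes the acceptance a probability and doubles the range of its exponent,
   whence [2 * eta] in the bounds. *)
have alb x : expR (- (2 * eta)) <= al x <= 1.
  rewrite /al -[X in _ && (_ <= X)]expR0 !ler_expR; have /andP[? ?] := ftf' x.
  by apply/andP; split; lra.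
have a01 w : 0 <= a w <= 1 by rewrite aal; have /andP[_ ->] := alb (X w); rewrite expR_ge0.
set q := reject_prob P0 a in lawo.
have q1E : ((1 - q)%:E = \int[P0]_w (a w)%:E)%E.
  by rewrite /q /reject_prob subKr fineK //; exact: accept_integral_fin.
have qb : expR (- (2 * eta)) <= 1 - q <= 1.
  have /andP[q0 _] : 0 <= q <= 1 by exact: reject_prob_bounds.
  apply/andP; split; last by lra.
  rewrite -lee_fin q1E.
  have -> : ((expR (- (2 * eta)))%:E = \int[P0]_x (cst (expR (- (2 * eta)))%:E) x)%E.
    by rewrite integral_cst // -[LHS]mule1; congr (_ * _)%E; apply/esym; exact: probability_setT.
  apply: ge0_le_integral => //.
  - by move=> y _; rewrite lee_fin expR_ge0.
  - exact/measurable_EFinP.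
  - by move=> y _; rewrite lee_fin aal; have /andP[] := alb (X y).
have q0 : 0 <= q by lra.
have q1 : q <= 1 by have := expR_gt0 (- (2 * eta)); lra.
have A0 : 0 < 1 - q by have := expR_gt0 (- (2 * eta)); lra.
set Z := fine (Zf f).
(* Under the proposal law [ft] cancels from the mean acceptance, leaving the integral of exp f. This
   is what eliminates Z in [hE]. *)
have qZ : 1 - q = expR (c - eta) * Z.
  apply: EFin_inj; rewrite q1E EFinM /Z (ZfE lamE mfc) fineK; last first.
    exact: (integral_exp_fin lam mfc fB measurableT).
  have mE : measurable_fun setT (fun y => (expR (fc y))%:E).
    by apply/measurable_EFinP; exact: measurableT_comp.
  have E0 y : setT y -> (0 <= (expR (fc y))%:E)%E by rewrite lee_fin expR_ge0.
  have c0 : (0 <= (expR (c - eta))%:E)%E by rewrite lee_fin expR_ge0.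
  rewrite -(ge0_integralZl lam measurableT mE E0 c0).
  transitivity (\int[P0]_w (al (X w))%:E)%E; first by apply: eq_integral => w _; rewrite aal.
  rewrite (lawX (fun x => (al x)%:E)); last 2 first.
  - exact/measurable_EFinP.
  - by move=> x; rewrite lee_fin expR_ge0.
  apply: eq_integral => x _; rewrite -!EFinM /al -!expRD; congr (expR _)%:E; ring.
have Z0 : 0 < Z by exact: (Zf_gt0 lamE mfc fB).
pose rho x := (geom q k * al x + q ^+ k) * expR (ft x + c).
have al0 x : 0 < al x by exact: expR_gt0.
have den x : (1 - q) * (geom q k * al x + q ^+ k) = (1 - q ^+ k) * al x + q ^+ k * (1 - q).
  by rewrite mulrDr mulrA geom_mul; ring.
have den0 x : 0 < (1 - q ^+ k) * al x + q ^+ k * (1 - q).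
  have p0 : 0 <= q ^+ k by rewrite exprn_ge0.
  have p1 : 0 <= 1 - q ^+ k by rewrite subr_ge0 exprn_ile1.
  have /andP[ax _] := alb x; have /andP[qx _] := qb.
  have := mulr_ge0 p1 (_ : 0 <= al x - expR (- (2 * eta))).
  have := mulr_ge0 p0 (_ : 0 <= 1 - q - expR (- (2 * eta))).
  by rewrite !subr_ge0 => /(_ qx) h1 /(_ ax) h2; have := expR_gt0 (- (2 * eta)); lra.
have g0 x : 0 < geom q k * al x + q ^+ k by rewrite -(pmulr_rgt0 _ A0) den.
have mrho : measurable_fun setT rho.
  apply: measurable_funM.
    by apply: measurable_funD => //; exact: measurable_funM.
  by apply: measurableT_comp => //; exact: measurable_funD.
have lawY g : measurable_fun setT g -> (forall x, 0 <= g x)%E ->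
    (\int[P]_w g (Y w) = \int[lam]_x (g x * (rho x)%:E))%E.
  move=> mg gp; rewrite YE.
  rewrite (lawo (g \o X)); last 2 first.
  - exact: measurableT_comp.
  - by move=> w; exact: gp.
  transitivity (\int[P0]_w (g (X w) * (geom q k * al (X w) + q ^+ k)%:E))%E.
    by apply: eq_integral => w _; rewrite aal.
  rewrite (lawX (fun x => g x * (geom q k * al x + q ^+ k)%:E))%E; last 2 first.
  - apply: emeasurable_funM => //; apply/measurable_EFinP; apply: measurable_funD => //.
    exact: measurable_funM.
  - by move=> x; rewrite mule_ge0 // lee_fin ltW.
  by apply: eq_integral => x _; rewrite -muleA -EFinM.
(* The reciprocal is 1 + q^k ((1 - q) / al - 1), where (1 - q) / al is the proposal density relative
   to P_f. *)
have hE x : expR (fc x) / Z / rho x = al x / ((1 - q ^+ k) * al x + q ^+ k * (1 - q)).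
  have -> : expR (fc x) = al x * expR (ft x + c) * expR (- (c - eta)).
    by rewrite /al -!expRD; congr expR; ring.
  rewrite expRN -den qZ /rho; field.
  by rewrite !gt_eqF ?expR_gt0.
have rho0 x : 0 < rho x by rewrite mulr_gt0 // expR_gt0.
have bnd x := @log_ratio_bounds R (al x) q (2 * eta) k (mulr_ge0 (ler0n R 2) eta0) (alb x) qb.
split=> [|t2]; apply: (D_suplog_le lamE mfc fB mrho rho0 lawY) => x; rewrite -/fc -/Z hE.
- by have [] := bnd x.
- by have [_] := bnd x; apply.
Qed.

End outer_rejection.

Section algorithm.
Context (R : realType) (d : nat) (Om T0 : Type).
Variables (G : seq 'rV[R]_d) (k : nat) (x : nat -> Om -> T0) (u : nat -> Om -> R).
Variables (X : seq R -> T0 -> 'rV[R]_d) (ft : seq R -> 'rV[R]_d -> R) (eta : R).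

(** The length of the history tells the stage, and its prefix [D] of grid values selects the
    proposal law. All k proposals are evaluated; acceptance is tested only at output, on the
    recorded values, so the fallback proposal of index k needs no evaluation. *)
Definition two_stage_alg : stoch_alg R d Om :=
  @StochAlg R d Om
    (fun w ys => if (size ys < size G)%N then nth 0 G (size ys)
                 else X (take (size G) ys) (x (size ys - size G) w))
    (fun w ys => let D := take (size G) ys in
       X D (x (find (fun j => u j w <=
                 expR (nth 0 ys (size G + j) - ft D (X D (x j w)) - eta)) (iota 0 k)) w)).

Lemma two_stage_in_cube : {in G, forall y, @cube R d y} ->
  (forall D w, @cube R d (X D w)) -> alg_in_cube two_stage_alg.
Proof.
move=> hG hX; split => w ys /=; last exact: hX.
by case: ifP => [h|_]; [apply: hG; exact: mem_nth|exact: hX].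
Qed.

Lemma infoS (A : stoch_alg R d Om) f w i :
  info A f w i.+1 = rcons (info A f w i) (f (next_pt A w (info A f w i))).
Proof. by []. Qed.

Lemma info_grid f w i : (i <= size G)%N ->
  info two_stage_alg f w i = [seq f y | y <- take i G].
Proof.
elim: i => [|i ih] iG; first by rewrite take0.
rewrite infoS (ih (ltnW iG)) /=.
by rewrite size_map (size_takel (ltnW iG)) iG (take_nth 0) // map_rcons.
Qed.

Lemma info_proposals f w j : let D := [seq f y | y <- G] in
  info two_stage_alg f w (size G + j) = D ++ [seq f (X D (x l w)) | l <- iota 0 j].
Proof.
move=> D; elim: j => [|j ih]; first by rewrite addn0 info_grid // take_size cats0.
have -> : iota 0 j.+1 = rcons (iota 0 j) j by rewrite -addn1 iotaD cats1.
rewrite map_rcons -rcons_cat addnS infoS ih; congr (rcons _ (f _)) => /=.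
rewrite size_cat !size_map size_iota ltnNge leq_addr /= addKn.
by rewrite take_size_cat ?size_map.
Qed.

Lemma two_stage_sample f w : let D := [seq f y | y <- G] in
  sample two_stage_alg (size G + k) f w =
  X D (x (find (fun j => u j w <= expR (f (X D (x j w)) - ft D (X D (x j w)) - eta)) (iota 0 k)) w).
Proof.
move=> D; rewrite /sample info_proposals /= take_size_cat ?size_map //.
congr (X _ (x _ w)); apply: eq_in_find => j; rewrite mem_iota add0n => /andP[_ jk].
rewrite nth_cat size_map ltnNge leq_addr /= addKn.
by rewrite (nth_map 0%N) ?size_iota // nth_iota.
Qed.

End algorithm.

(** The algorithm sees only the grid values, so fhat must be a function of [ys]. Data that no member
    of the class produces receive the zero function, which keeps a proposal law defined for every
    [ys]. *)
Lemma matching_choice (R : realType) (d m : nat) (B : R) (G : seq 'rV[R]_d) : 0 < B ->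
  exists F : seq R -> 'rV[R]_d -> R, forall ys,
  [/\ measurable_fun setT (F ys \o @clip R d), forall y, `|(F ys \o @clip R d) y| <= B &
   forall f, Fclass m B f -> ys = [seq f y | y <- G] ->
     Fclass m B (F ys) /\ [seq F ys y | y <- G] = ys].
Proof.
move=> B0; suff /choice[F hF] : forall ys, exists F : 'rV[R]_d -> R,
    [/\ measurable_fun setT (F \o @clip R d), forall y, `|(F \o @clip R d) y| <= B &
     forall f, Fclass m B f -> ys = [seq f y | y <- G] ->
       Fclass m B F /\ [seq F y | y <- G] = ys] by exists F.
move=> ys.
have [[f [Ff fG]]|nex] := pselect (exists f, Fclass m B f /\ ys = [seq f y | y <- G]).
  exists f; split => [|y|_ _ _]; last by [].
  - by apply: continuous_measurable_rV; exact: (Fclass_continuous Ff).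
  - exact: Fclass_bounded Ff y.
exists (fun=> 0); split => [|y|f Ff fG]; first exact: measurable_cst.
- by rewrite /= normr0 ltW.
- by exfalso; apply: nex; exists f.
Qed.

(** Two errors of size e add up, f against fhat and fhat against [ft], so eta = 2e and the
    acceptance exponent ranges over 4e. *)
Lemma two_stage_error (R : realType) (d m : nat) (B e : R) (G : seq 'rV[R]_d) (k : nat) :
  0 < B -> 0 < e -> {in G, forall y, @cube R d y} ->
  (forall f g, Fclass m B f -> Fclass m B g -> [seq f y | y <- G] = [seq g y | y <- G] ->
     forall y, `|f (clip y) - g (clip y)| <= e) ->
  let err := @err_adstoch R d (size G + k) (@Fclass R d m B) in
  (err <= (4 * e)%:E)%E /\ (4 * e <= 2^-1 -> (err <= (2 * (4 * e) ^+ k.+1)%:E)%E).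
Proof.
move=> B0 e0 Gc Ge err.
have [lam lamE] := cube_probability R d.
have [d0 [T0 [P0 HP]]] := proposal_sampler lamE B0 e0.
have [F hF] := matching_choice m G B0.
have /choice[S hS] : forall ys, exists S : (T0 -> 'rV[R]_d) * ('rV[R]_d -> R) * R,
  [/\ measurable_fun setT S.1.1, forall w, @cube R d (S.1.1 w), measurable_fun setT S.1.2,
    forall y, `|S.1.2 y - (F ys \o @clip R d) y| <= e &
    forall g : 'rV[R]_d -> \bar R, measurable_fun setT g -> (forall y, 0 <= g y)%E ->
    (\int[P0]_w g (S.1.1 w) = \int[lam]_y (g y * (expR (S.1.2 y + S.2))%:E))%E].
  move=> ys; have [mF bF _] := hF ys.
  by have [X [ft [c hX]]] := HP _ mF bF; exists (X, ft, c).
have [dO [Om [P [x [u HO]]]]] := rejection_sampler P0 k.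
pose A := two_stage_alg G k x u (fun ys => (S ys).1.1) (fun ys => (S ys).1.2) (2 * e).
have step f : Fclass m B f -> measurable_fun setT (sample A (size G + k) f) /\
    forall Y : {mfun Om >-> 'rV[R]_d}, (Y : Om -> 'rV[R]_d) = sample A (size G + k) f ->
    (D_suplog (Pf f) (distribution P Y) <= (4 * e)%:E)%E /\
    (4 * e <= 2^-1 -> (D_suplog (Pf f) (distribution P Y) <= (2 * (4 * e) ^+ k.+1)%:E)%E).
  move=> Ff; pose D := [seq f y | y <- G].
  have [mX Xc mft ftF lawX] := hS D; have [_ _ /(_ f Ff erefl)[FF FG]] := hF D.
  have mfc : measurable_fun setT (f \o @clip R d).
    by apply: continuous_measurable_rV; exact: (Fclass_continuous Ff).
  have fft y : `|(f \o @clip R d) y - (S D).1.2 y| <= 2 * e.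
    have := ftF y; have := Ge f (F D) Ff FF (esym FG) y.
    by rewrite /= !ler_norml => /andP[? ?] /andP[? ?]; apply/andP; split; lra.
  pose a w := expR (f ((S D).1.1 w) - (S D).1.2 ((S D).1.1 w) - 2 * e).
  have aE : a = (fun y => expR ((f \o @clip R d) y - (S D).1.2 y - 2 * e)) \o (S D).1.1.
    by apply/funext => w; rewrite /a /= clip_id.
  have ma : measurable_fun setT a.
    rewrite aE; apply: measurableT_comp => //; apply: measurableT_comp => //.
    by apply: measurable_funB => //; exact: measurable_funB.
  have a01 w : 0 <= a w <= 1.
    rewrite aE expR_ge0 /= -[leRHS]expR0 ler_expR subr_le0.
    by apply: le_trans (fft _); exact: ler_norm.
  have [] := HO a ma a01; set out := (fun w => _) => mout hout.
  have sE : sample A (size G + k) f = (S D).1.1 \o out.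
    by apply/funext => w; exact: two_stage_sample.
  split; first by rewrite sE; exact: (measurableT_comp mX mout).
  move=> Y; rewrite sE => YE.
  have [] := rejection_suplog lamE mfc (Fclass_bounded Ff) mft fft Xc lawX mX erefl hout YE.
  by rewrite (_ : 2 * (2 * e) = 4 * e); [|ring].
have errA : (err <= alg_error P A (size G + k) (@Fclass R d m B))%E.
  apply: ereal_inf_lbound; exists dO, Om, P, A; split => //.
  - by apply: two_stage_in_cube => // ys w; have [_ + _ _ _] := hS ys; apply.
  - by move=> f /step[].
split=> [|e4]; apply: (le_trans errA); apply: ge_ereal_sup => _ [f [Ff [Y [YE ->]]]];
  have [_ /(_ Y YE)[b1 b2]] := step f Ff => //.
exact: b2.
Qed.

Theorem theorem9 (R : realType) (d m : nat) :
  (1 <= d)%N -> (1 <= m)%N ->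
  exists C C' : R, 0 < C /\ 0 < C' /\
    forall (B : R) (n : nat), 0 < B -> (1 <= n)%N ->
      let r := C * B * (n%:R `^ (- (m%:R / d%:R))) in
      (1 < r -> (@err_adstoch R d n (@Fclass R d m B) <= (C' * B * (n%:R `^ (- (m%:R / d%:R))))%:E)%E) /\
      (r <= 1 -> (@err_adstoch R d n (@Fclass R d m B) <= (C' * r `^ (n%:R / 2 + 1))%:E)%E).
Proof.
move=> d0 _; have [c0 c0pos grid] := grid_approximation R m d0.
(* With C = 8 c0 one has r = 2 (4e), so r at most 1 is exactly the condition 4e at most 1/2. C'
   dominates both prefactors, 4 c0 and 2. *)
exists (8 * c0), (2 + 4 * c0); split; first by rewrite mulr_gt0.
split; first by rewrite addr_gt0 ?mulr_gt0.
move=> B n B0 n0 r.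
have [G [Gn Gc Ge]] := grid n n0.
pose e := c0 * (B * n%:R `^ (- (m%:R / d%:R))).
have e0 : 0 < e by rewrite !mulr_gt0 ?powR_gt0 ?ltr0n.
have n2 := odd_double_half n.
pose k := (n - size G)%N.
have nk : (size G + k)%N = n by rewrite /k; lia.
have [] := @two_stage_error R d m B e G k B0 e0 Gc (fun f g => Ge B f g B0).
rewrite nk => err1 err2; split => [_|r1].
  apply: (le_trans err1); rewrite lee_fin /e.
  have : 0 < B * n%:R `^ (- (m%:R / d%:R)) by rewrite mulr_gt0 ?powR_gt0 ?ltr0n.
  by rewrite -mulrA; nra.
have rE : r = 2 * (4 * e) by rewrite /r /e; ring.
have e4 : 4 * e <= 2^-1 by lra.
have r0 : 0 < r by rewrite rE; lra.
apply: (le_trans (err2 e4)); rewrite lee_fin.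
have h1 : (4 * e) ^+ k.+1 <= r ^+ k.+1 by apply: lerXn2r; rewrite ?nnegrE ?rE; lra.
(* As r is at most 1, a larger exponent gives a smaller power, and k is at least n/2 because the
   grid took at most [n./2] points. *)
have h2 : r ^+ k.+1 <= r `^ (n%:R / 2 + 1).
  have r01 : 0 < r <= 1 by rewrite r0.
  rewrite -(powR_mulrn _ (ltW r0)); apply: (ger_powR r01).
  have : n%:R <= (k * 2)%:R :> R by rewrite ler_nat /k; lia.
  by rewrite natrM => nk2; rewrite -[k.+1%:R]natr1; lra.
have h3 : 0 <= r `^ (n%:R / 2 + 1) by exact: powR_ge0.
nra.
Qed.
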